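(* Let $I\subseteq\mathbb{R}$ be a nonempty open interval and let $f:I\to\mathbb{R}$ be a function. (i) Let $n\in\mathbb{N}\setminus\{1\}$. If the inequality $$f\left(\frac{x_1+\cdots+x_n}{n}\right)\leq\frac{1}{n}\sum_{i=1}^n f\left(\frac{x_1+\cdots+x_n-x_i}{n-1}\right)$$ holds for all $x_1,\dots,x_n\in I$, then $f$ is Jensen convex on $I$. (ii) If $f$ is Jensen convex on $I$, then the inequality $$f\left(\frac{x_1+\cdots+x_n}{n}\right)\leq\frac{1}{n}\sum_{i=1}^n f\left(\frac{x_1+\cdots+x_n-x_i}{n-1}\right)$$ holds for all $n\in\mathbb{N}\setminus\{1\}$ and all $x_1,\dots,x_n\in I$.
   Context: $\mathbb{N}$ denotes the set of positive integers. A function $f:I\to\mathbb{R}$ is Jensen convex on $I$ if $f\left(\frac{x+y}{2}\right)\leq\frac{f(x)+f(y)}{2}$ for all $x,y\in I$. *)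

(* Defs.v *)
From HB Require Import structures.
From mathcomp Require Import all_boot all_order all_algebra.
From mathcomp Require Import all_classical all_reals all_analysis.
Set Implicit Arguments.
Unset Strict Implicit.
Unset Printing Implicit Defensive.
Import Order.TTheory GRing.Theory Num.Theory.
Import numFieldNormedType.Exports.
Local Open Scope classical_set_scope.
Local Open Scope ring_scope.

(* A function I -> R is represented by a total f : R -> R of which only the
   values on I are constrained: I is meant to be an interval, so midpoints of
   points of I are again in I. *)
Definition jensen_convex (R : realType) (I : set R) (f : R -> R) : Prop :=
  forall x y : R, I x -> I y -> f ((x + y) / 2) <= (f x + f y) / 2.

(* Main.v *)
Require Import Defs.
From HB Require Import structures.
From mathcomp Require Import all_boot all_order all_algebra.
From mathcomp Require Import all_classical all_reals all_analysis.
From mathcomp Require Import ring lra.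
Set Implicit Arguments.
Unset Strict Implicit.
Unset Printing Implicit Defensive.
Import Order.TTheory GRing.Theory Num.Theory.
Import numFieldNormedType.Exports.
Local Open Scope classical_set_scope.
Local Open Scope ring_scope.

(** Write S for the sum of the x_j and y_i = (S - x_i) / (n - 1), so that the
    y_i have the same mean as the x_i.

    For (ii), each y_i is a mean of n - 1 points of I, hence lies in I, and the
    inequality is the n-point Jensen inequality at the y_i ([jensen_mean]).  No
    regularity of f is available, so that inequality comes from Cauchy's
    argument: it holds for 2 ^ k points by doubling, and n points are padded
    with copies of their mean up to a power of two.

    For (i), the points x = (m + (n-1)h, m - (n-1)h, m, ..., m) give
    y = (m - h, m + h, m, ..., m); the n - 2 terms f m cancel, and what remains
    is 2 f m <= f (m - h) + f (m + h) ([leave_one_out_local]).  This asks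
    m +- (n-1)h, rather than m +- h, to lie in I, so it is a local form of
    Jensen convexity.  As I is open, a step h that is small enough works at
    all points of the segment between two given points u and v of I.  Cutting
    this segment into 2N equal steps, the values of f at the nodes form a
    discretely convex sequence, whose middle term is at most the mean of its end
    terms ([discrete_midpoint]). *)

(** The sums g j = f (m + j h) + f (m - j h) satisfy
    2 g (j + 1) <= g j + g (j + 2) and g 0 <= g 1, so they are nondecreasing,
    and the conclusion compares g 0 with g N. *)
Lemma discrete_midpoint (R : realFieldType) (f : R -> R) (m h : R) (N : nat) :
  (forall j : nat, (j < N)%N ->
     2 * f (m + j%:R * h) <= f (m + j%:R * h - h) + f (m + j%:R * h + h) /\
     2 * f (m - j%:R * h) <= f (m - j%:R * h - h) + f (m - j%:R * h + h)) ->
  2 * f m <= f (m + N%:R * h) + f (m - N%:R * h).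
Proof.
move=> midf; pose g (j : nat) := f (m + j%:R * h) + f (m - j%:R * h).
have g_step j : (j < N)%N -> g j <= g j.+1.
  elim: j => [N0|j IHj ltjN].
    have [+ _] := midf _ N0.
    by rewrite /g !mul0r mul1r subr0 !addr0; lra.
  have := IHj (ltnW ltjN); have [] := midf _ ltjN.
  rewrite /g.
  have -> : m + j.+1%:R * h - h = m + j%:R * h by rewrite -[j.+1]addn1 natrD; ring.
  have -> : m - j.+1%:R * h + h = m - j%:R * h by rewrite -[j.+1]addn1 natrD; ring.
  have -> : m + j.+1%:R * h + h = m + j.+2%:R * h.
    by rewrite -[j.+2]addn1 natrD; ring.
  have -> : m - j.+1%:R * h - h = m - j.+2%:R * h.
    by rewrite -[j.+2]addn1 natrD; ring.
  lra.
have g_le j : (j <= N)%N -> g 0%N <= g j.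
  elim: j => // j IHj ltjN.
  exact: le_trans (IHj (ltnW ltjN)) (g_step _ ltjN).
by have := g_le _ (leqnn N); rewrite /g !mul0r subr0 addr0; lra.
Qed.

Lemma interval_convex (R : realFieldType) (I : set R) (a b t : R) :
  is_interval I -> I a -> I b -> 0 <= t <= 1 -> I (a + t * (b - a)).
Proof.
move=> I_itv Ia Ib /andP[t0 t1]; have [leab|ltba] := leP a b.
  by apply: (I_itv a b) => //; apply/andP; split; nra.
by apply: (I_itv b a) => //; apply/andP; split; nra.
Qed.

(** The mean of n + 1 points is a convex combination of the mean of the first
    n and the last one, with weight 1 / (n + 1) on the latter. *)
Lemma interval_mean (R : realFieldType) (I : set R) (n : nat)
    (x : 'I_n.+1 -> R) :
  is_interval I -> (forall i, I (x i)) -> I ((\sum_(i < n.+1) x i) / n.+1%:R).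
Proof.
move=> I_itv; elim: n x => [|n IHn] x Ix; first by rewrite big_ord1 divr1.
rewrite big_ord_recr /=.
set s := \sum_(i < _) _.
have Is : I (s / n.+1%:R) by apply: IHn.
have -> : (s + x ord_max) / n.+2%:R =
          s / n.+1%:R + n.+2%:R^-1 * (x ord_max - s / n.+1%:R).
  by rewrite -[n.+2%:R]natr1; field; rewrite !(nat1r, natr1) !pnatr_eq0.
apply: interval_convex => //.
by rewrite invr_ge0 ler0n invf_le1 ?ltr0n // ler1n.
Qed.

Lemma jensen_dyadic (R : realType) (I : set R) (f : R -> R) (k : nat)
    (x : nat -> R) :
  is_interval I -> jensen_convex I f -> (forall i, I (x i)) ->
  f ((\sum_(i < 2 ^ k) x i) / (2 ^ k)%:R) <=
    (\sum_(i < 2 ^ k) f (x i)) / (2 ^ k)%:R.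
Proof.
move=> I_itv fJ; elim: k x => [|k IHk] x Ix.
  by rewrite expn0 !big_ord1 !divr1.
have p0 : (2 ^ k)%:R != 0 :> R by rewrite pnatr_eq0 expn_eq0.
have mean_in (y : nat -> R) : (forall i, I (y i)) ->
    I ((\sum_(i < 2 ^ k) y i) / (2 ^ k)%:R).
  move=> Iy; have := expn_gt0 2 k; case: (2 ^ k)%N => // q _.
  exact: interval_mean.
rewrite expnS mul2n -addnn natrD !big_split_ord /=.
have split_mean (a b : R) : (a + b) / ((2 ^ k)%:R + (2 ^ k)%:R) =
    (a / (2 ^ k)%:R + b / (2 ^ k)%:R) / 2.
  by field; rewrite p0 -mulr2n -mulr_natr mulf_neq0 // pnatr_eq0.
rewrite !split_mean.
pose x' i := x (2 ^ k + i)%N.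
have Ix' i : I (x' i) by exact: Ix.
have := fJ _ _ (mean_in _ Ix) (mean_in _ Ix').
have := IHk _ Ix; have := IHk _ Ix'; rewrite /x'; lra.
Qed.

(** Cauchy's backward step: the points are padded with their mean m up to
    2 ^ n >= n points, which leaves the mean unchanged and adds the same
    multiple of f m to both sides. *)
Lemma jensen_mean (R : realType) (I : set R) (f : R -> R) (n : nat)
    (x : 'I_n.+1 -> R) :
  is_interval I -> jensen_convex I f -> (forall i, I (x i)) ->
  f ((\sum_(i < n.+1) x i) / n.+1%:R) <= (\sum_(i < n.+1) f (x i)) / n.+1%:R.
Proof.
move=> I_itv fJ Ix; set m := (\sum_(i < _) x i) / _.
have Im : I m by exact: interval_mean.
pose y (i : nat) := if (i < n.+1)%N then x (inord i) else m.
have Iy i : I (y i) by rewrite /y; case: ifP.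
have := jensen_dyadic n.+1 I_itv fJ Iy.
have /subnKC <- : (n.+1 <= 2 ^ n.+1)%N by exact/ltnW/ltn_expl.
set d := (2 ^ n.+1 - n.+1)%N.
have y_sum (g : R -> R) : \sum_(i < n.+1 + d) g (y i) =
    \sum_(i < n.+1) g (x i) + d%:R * g m.
  rewrite big_split_ord /=; congr (_ + _).
    by apply: eq_bigr => i _; rewrite /y ltn_ord inord_val.
  rewrite (eq_bigr (fun=> g m)) => [|i _]; last by rewrite /y ltnNge leq_addr.
  by rewrite sumr_const card_ord mulr_natl.
rewrite (y_sum id) (y_sum f) natrD.
have n0 : 0 < n.+1%:R :> R by rewrite ltr0n.
have d0 : 0 <= d%:R :> R by rewrite ler0n.
have -> : \sum_(i < n.+1) x i = m * n.+1%:R by rewrite /m divfK ?gt_eqF.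
have -> : (m * n.+1%:R + d%:R * m) / (n.+1%:R + d%:R) = m.
  by field; rewrite gt_eqF // ltr_wpDr.
rewrite ler_pdivlMr ?ltr_wpDr // ler_pdivlMr //; lra.
Qed.

(** The inequality of the theorem at x = (m + (n-1)h, m - (n-1)h, m, ..., m),
    with n = k + 2. *)
Lemma leave_one_out_local (R : realFieldType) (I : set R) (f : R -> R)
    (k : nat) (m h : R) :
  (forall x : 'I_k.+2 -> R, (forall i, I (x i)) ->
     f ((\sum_(j < k.+2) x j) / k.+2%:R) <=
     k.+2%:R^-1 *
       \sum_(i < k.+2) f (((\sum_(j < k.+2) x j) - x i) / (k.+2%:R - 1))) ->
  I m -> I (m + k.+1%:R * h) -> I (m - k.+1%:R * h) ->
  2 * f m <= f (m - h) + f (m + h).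
Proof.
move=> ineq Im Ip Iq.
pose x (i : 'I_k.+2) : R :=
  match val i with
  | 0%N => m + k.+1%:R * h
  | 1%N => m - k.+1%:R * h
  | _ => m
  end.
have Ix i : I (x i) by rewrite /x; case: (val i) => [|[|?]].
have n2 : k.+2%:R = k%:R + 2 :> R by rewrite -addn2 natrD.
have n1 : k.+1%:R = k%:R + 1 :> R by rewrite -natr1.
have k0 : 0 <= k%:R :> R by rewrite ler0n.
have k1_neq0 : k%:R + 1 != 0 :> R by rewrite gt_eqF //; lra.
have k2_neq0 : k%:R + 2 != 0 :> R by rewrite gt_eqF //; lra.
have k21 : k%:R + 2 - 1 = k%:R + 1 :> R by ring.
have x_sum : \sum_(j < k.+2) x j = (k%:R + 2) * m.
  rewrite !big_ord_recl /= (eq_bigr (fun=> m)) // sumr_const card_ord.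
  by rewrite /x /= -[m *+ k]mulr_natl; ring.
have := ineq _ Ix; rewrite x_sum n2 k21 !big_ord_recl /=.
rewrite (eq_bigr (fun=> f m)) => [|i _]; last first.
  by rewrite /x /=; congr f; field.
rewrite sumr_const card_ord /x /= n1 -[f m *+ k]mulr_natl.
have -> : (k%:R + 2) * m / (k%:R + 2) = m by field.
have -> : ((k%:R + 2) * m - (m + (k%:R + 1) * h)) / (k%:R + 1) = m - h by field.
have -> : ((k%:R + 2) * m - (m - (k%:R + 1) * h)) / (k%:R + 1) = m + h by field.
rewrite mulrC ler_pdivlMr; last by lra.
lra.
Qed.

(** A midpoint inequality that is known only where m +- c h stays in I
    propagates to all of I: the room around two points u, v of the open set I
    is also available, by convexity, around all points between them. *)
Lemma local_jensen_convex (R : realType) (I : set R) (f : R -> R) (c : R) :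
  is_interval I -> open I ->
  (forall m h, I m -> I (m + c * h) -> I (m - c * h) ->
     2 * f m <= f (m - h) + f (m + h)) ->
  jensen_convex I f.
Proof.
move=> I_itv I_open locf u v Iu Iv.
have [e e0 [ue ve]] : exists2 e : R, 0 < e &
    (forall z, `|z - u| < e -> I z) /\ (forall z, `|z - v| < e -> I z).
  have room w : I w -> exists2 e : R, 0 < e & forall z, `|z - w| < e -> I z.
    move=> Iw; have /nbhs_ballP[e /= e0 be] := open_nbhs_nbhs (conj I_open Iw).
    by exists e => // z ze; apply: be; rewrite -ball_normE /= distrC.
  have [e1 e10 P1] := room _ Iu; have [e2 e20 P2] := room _ Iv.
  exists (Num.min e1 e2); first by rewrite lt_min e10.
  by split=> z; rewrite lt_min => /andP[? ?]; [apply: P1|apply: P2].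
(* N steps of length |h| lead from the midpoint to either end, |c h| < e. *)
pose B := `|c * (v - u)| / e.
pose N := (Num.truncn B).+1.
pose h := (v - u) / (2 * N%:R).
have N0 : 0 < N%:R :> R by rewrite ltr0n.
have B0 : 0 <= B by rewrite divr_ge0 // ltW.
have ltBN : B < N%:R by rewrite /N; exact: truncnS_gt.
have ch_e : `|c * h| < e.
  have -> : c * h = c * (v - u) / (2 * N%:R) by rewrite /h mulrA.
  rewrite normrM normfV (gtr0_norm (_ : 0 < 2 * N%:R)) ?mulr_gt0 //.
  rewrite ltr_pdivrMr ?mulr_gt0 //.
  move: ltBN; rewrite /B ltr_pdivrMr //.
  by have := mulr_gt0 N0 e0; lra.
have ends s : `|s| < e -> I (u + s) /\ I (v + s).
  by move=> se; split; [apply: ue|apply: ve]; rewrite addrC addKr.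
have seg t s : 0 <= t <= 1 -> `|s| < e -> I (u + t * (v - u) + s).
  move=> t01 /ends[Ius Ivs].
  have -> : u + t * (v - u) + s = (u + s) + t * ((v + s) - (u + s)) by ring.
  exact: interval_convex.
have locseg t : 0 <= t <= 1 ->
    2 * f (u + t * (v - u)) <= f (u + t * (v - u) - h) + f (u + t * (v - u) + h).
  move=> t01; apply: locf; first exact: interval_convex.
  - exact: seg.
  - by apply: seg => //; rewrite normrN.
have := @discrete_midpoint R f ((u + v) / 2) h N.
have N_neq0 : N%:R != 0 :> R by rewrite gt_eqF.
have -> : (u + v) / 2 + N%:R * h = v by rewrite /h; field.
have -> : (u + v) / 2 - N%:R * h = u by rewrite /h; field.
move=> mid; suff : 2 * f ((u + v) / 2) <= f v + f u by lra.
apply: mid => j ltjN.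
(* The nodes (u + v) / 2 +- j h are at the ratios 1/2 +- j / (2 N) of [u, v]. *)
pose r : R := j%:R / (2 * N%:R).
have r_bnd : 0 <= r <= 1 / 2.
  rewrite /r divr_ge0 ?mulr_ge0 //= ler_pdivrMr ?mulr_gt0 //.
  have : j%:R <= N%:R :> R by rewrite ler_nat ltnW.
  lra.
have -> : (u + v) / 2 + j%:R * h = u + (1 / 2 + r) * (v - u).
  by rewrite /h /r; field.
have -> : (u + v) / 2 - j%:R * h = u + (1 / 2 - r) * (v - u).
  by rewrite /h /r; field.
by case/andP: r_bnd => r0 r1; split; apply: locseg; apply/andP; split; lra.
Qed.

Theorem corollary3p3 (R : realType) (I : set R) (I_itv : is_interval I)
    (I_open : open I) (I_neq0 : I !=set0) (f : R -> R) :
  (forall n : nat, (2 <= n)%N ->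
     (forall x : 'I_n -> R, (forall i, I (x i)) ->
        f ((\sum_(j < n) x j) / n%:R) <=
        n%:R^-1 * \sum_(i < n) f (((\sum_(j < n) x j) - x i) / (n%:R - 1))) ->
     jensen_convex I f)
  /\
  (jensen_convex I f ->
     forall n : nat, (2 <= n)%N ->
     forall x : 'I_n -> R, (forall i, I (x i)) ->
        f ((\sum_(j < n) x j) / n%:R) <=
        n%:R^-1 * \sum_(i < n) f (((\sum_(j < n) x j) - x i) / (n%:R - 1))).
Proof.
split=> [[|[|k]] // _ ineq | fJ [|[|k]] // _ x Ix].
  apply: (@local_jensen_convex R I f k.+1%:R) => // m h.
  exact: leave_one_out_local.
have k21 : k.+2%:R - 1 = k.+1%:R :> R by rewrite -[k.+2%:R]natr1 addrK.
rewrite k21; set S := \sum_(j < _) x j.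
pose y i := (S - x i) / k.+1%:R.
have Iy i : I (y i).
  rewrite /y /S (bigD1_ord i) //= addrC addrK.
  exact: interval_mean.
have y_sum : \sum_i y i = S.
  rewrite -mulr_suml big_split /= sumr_const card_ord sumrN -/S.
  rewrite -[S *+ _]mulr_natr -[X in _ - X]mulr1 -mulrBr k21.
  by rewrite mulfK.
by rewrite [leRHS]mulrC; have := jensen_mean I_itv fJ Iy; rewrite y_sum.
Qed.
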